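(* Let $(G,\tau)$ and $(H,\sigma)$ be topological groups and $f:(G,\tau)\to(H,\sigma)$ a continuous surjective homomorphism. Then there exist a topological group $(\widetilde G,\widetilde\tau)$ containing $(G,\tau)$ as a topological subgroup and an open continuous homomorphism $\widetilde f:(\widetilde G,\widetilde\tau)\to(H,\sigma)$ such that $\widetilde f\restriction_G=f$; and if $(H,\sigma)$ is Hausdorff, then $(G,\tau)$ is closed in $(\widetilde G,\widetilde\tau)$.
   Context: Topological groups are not assumed Hausdorff. ''Containing $(G,\tau)$ as a topological subgroup'' means that $G$ is (identified, via a topological embedding that is a homomorphism, with) a subgroup of $\widetilde G$ and $\widetilde\tau\restriction_G=\tau$. *)

(* Defs.v *)
From HB Require Import structures.
From mathcomp Require Import all_boot.
From mathcomp Require Import all_classical all_analysis.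

Set Implicit Arguments.
Unset Strict Implicit.
Unset Printing Implicit Defensive.

Local Open Scope classical_set_scope.
Local Open Scope group_scope.

HB.structure Definition PreTopologicalGroup := {G of Topological G & Group G}.

(* No separation axiom is required. *)
HB.mixin Record PreTopologicalGroup_isTopologicalGroup G
    & PreTopologicalGroup G := {
  mulg_continuous : continuous (fun x : G * G => x.1 * x.2) ;
  invg_continuous : continuous (fun x : G => x^-1)
}.

#[short(type="topologicalGroupType")]
HB.structure Definition TopologicalGroup :=
  {G of PreTopologicalGroup G & PreTopologicalGroup_isTopologicalGroup G}.

Definition open_map (S T : topologicalType) (f : S -> T) : Prop :=
  forall U : set S, open U -> open (f @` U).

(* The open sets of [initial_topology f] are the preimages under [f] of the
   open sets of [T], so [f] is a homeomorphism onto its range, the latter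
   carrying the subspace topology. *)
Definition topological_embedding (S T : topologicalType) (f : S -> T) : Prop :=
  injective f /\ @open S = @open (initial_topology f).

(* Main.v *)
Require Import Defs.
From HB Require Import structures.
From mathcomp Require Import all_boot.
From mathcomp Require Import all_classical all_analysis.

(** The group [Gt] is the direct product [G * H], which contains [G] as the
    graph of [f]: put [iota x = (x, f x)] and let [ft] be the second
    projection.  Then [ft (iota x) = f x] by definition, and a projection of a
    product is continuous and open whatever [f] is.  The first projection is a
    continuous left inverse of [iota], so continuity of [f] makes [iota] an
    embedding ([graph_embedding]).  The range of [iota] is the graph of a
    continuous map, hence closed as soon as [H] is Hausdorff
    ([closed_graph]). *)

Set Implicit Arguments.
Unset Strict Implicit.
Unset Printing Implicit Defensive.

Local Open Scope classical_set_scope.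
Local Open Scope group_scope.

(** * Graphs of continuous maps *)

Section Graph.
Context {S T : topologicalType} (f : S -> T) (f_continuous : continuous f).

Lemma graph_continuous : continuous (fun x => (x, f x)).
Proof. by move=> x; apply: cvg_pair; [exact: cvg_id|exact: f_continuous]. Qed.

(** An open set [A] of [S] is the preimage of the open cylinder [A * T]. *)
Lemma graph_embedding : topological_embedding (fun x => (x, f x)).
Proof.
split=> [x y [] //|]; apply/seteqP; split=> [A oA|_ [B oB <-]].
  exists (fst @^-1` A) => //.
  by apply: open_comp => // -[a b] _; exact: cvg_fst.
by apply: open_comp => // x _; exact: graph_continuous.
Qed.

(** If [(a, b)] is adherent to the graph, then [b] and [f a] cannot be
    separated: the product of a neighbourhood of [b] with the preimage of a
    neighbourhood of [f a] meets the graph. *)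
Lemma closed_graph : hausdorff_space T -> closed (range (fun x => (x, f x))).
Proof.
move=> hT [a b] ab_adh; exists a => //; congr pair; apply: esym.
apply: hT => A B bA faB.
have [|_ [[x _ <-] [fxB fxA]]] := ab_adh (f @^-1` B `*` A).
  by exists (f @^-1` B, A) => //; split=> //; exact: f_continuous.
by exists (f x).
Qed.

End Graph.

(** * Products of topological groups *)

Section ProductGroup.
Context {G H : groupType}.

Definition pair_mulg (x y : G * H) : G * H := (x.1 * y.1, x.2 * y.2).
Definition pair_invg (x : G * H) : G * H := (x.1^-1, x.2^-1).

Lemma pair_mulgA : associative pair_mulg.
Proof. by move=> x y z; rewrite /pair_mulg /= !mulgA. Qed.

Lemma pair_mul1g : left_id (1, 1) pair_mulg.
Proof. by case=> x y; rewrite /pair_mulg /= !mul1g. Qed.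

Lemma pair_mulg1 : right_id (1, 1) pair_mulg.
Proof. by case=> x y; rewrite /pair_mulg /= !mulg1. Qed.

Lemma pair_mulVg : left_inverse (1, 1) pair_invg pair_mulg.
Proof. by move=> x; rewrite /pair_mulg /= !mulVg. Qed.

Lemma pair_mulgV : right_inverse (1, 1) pair_invg pair_mulg.
Proof. by move=> x; rewrite /pair_mulg /= !mulgV. Qed.

HB.instance Definition _ := isGroup.Build (G * H)%type
  pair_mulgA pair_mul1g pair_mulg1 pair_mulVg pair_mulgV.

End ProductGroup.

Section ProductTopologicalGroup.
Context {G H : topologicalGroupType}.

Lemma pair_mulg_continuous :
  continuous (fun x : (G * H) * (G * H) => x.1 * x.2).
Proof.
move=> x; apply: cvg_pair.
  apply: (@continuous2_cvg _ _ _ _ _ _ (fun z => z.1.1) (fun z => z.2.1)).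
  - exact: (@mulg_continuous G (x.1.1, x.2.1)).
  - exact: (@continuous_comp _ _ _ fst fst x cvg_fst cvg_fst).
  - exact: (@continuous_comp _ _ _ snd fst x cvg_snd cvg_fst).
apply: (@continuous2_cvg _ _ _ _ _ _ (fun z => z.1.2) (fun z => z.2.2)).
- exact: (@mulg_continuous H (x.1.2, x.2.2)).
- exact: (@continuous_comp _ _ _ fst snd x cvg_fst cvg_snd).
- exact: (@continuous_comp _ _ _ snd snd x cvg_snd cvg_snd).
Qed.

Lemma pair_invg_continuous : continuous (fun x : G * H => x^-1).
Proof.
case=> a b; apply: cvg_pair => /=.
  by apply: cvg_comp cvg_fst _; exact: invg_continuous.
by apply: cvg_comp cvg_snd _; exact: invg_continuous.
Qed.

HB.instance Definition _ := PreTopologicalGroup_isTopologicalGroup.Build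
  (G * H)%type pair_mulg_continuous pair_invg_continuous.

End ProductTopologicalGroup.

Lemma snd_morphism (G H : groupType) : {morph @snd G H : x y / x * y}.
Proof. by []. Qed.

HB.instance Definition _ (G H : groupType) :=
  isMultiplicative.Build (G * H)%type H snd (@snd_morphism G H).

Section GraphMorphism.
Context {G H : groupType} (f : {multiplicative G -> H}).

Definition graph_embed (x : G) : G * H := (x, f x).

Lemma graph_embed_morphism : {morph graph_embed : x y / x * y}.
Proof. by move=> x y; rewrite /graph_embed gmulfM. Qed.

HB.instance Definition _ :=
  isMultiplicative.Build G (G * H)%type graph_embed graph_embed_morphism.

End GraphMorphism.

Theorem theorem1p1 (G H : topologicalGroupType) (f : {multiplicative G -> H})
    (f_continuous : continuous f) (f_surjective : range f = [set: H]) :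
  exists (Gt : topologicalGroupType)
         (iota : {multiplicative G -> Gt})
         (ft : {multiplicative Gt -> H}),
    [/\ topological_embedding iota,
        continuous ft,
        open_map ft,
        (forall x : G, ft (iota x) = f x)
      & hausdorff_space H -> closed (range iota)].
Proof.
exists (G * H)%type, (graph_embed f), snd; split=> //.
- exact: graph_embedding.
- by case=> a b; exact: cvg_snd.
- by move=> U; exact: snd_open.
- exact: closed_graph.
Qed.
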